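(* Let $\mathbf{E}$ be a field, let $H$ be a subgroup of $\mathrm{Aut}(\mathbf{E})$, and let $\mathcal{L}_H=\{\ell(\mathcal{O}_H(\alpha))\mid\alpha\in\mathbf{E}\}$ be the set of $H$-orbit lengths. (i) The extension $\mathbf{E}/\mathbf{E}^H$ is Galois if and only if $\mathcal{L}_H\subseteq\mathbb{N}$, i.e. every $H$-orbit is finite. (ii) The extension $\mathbf{E}/\mathbf{E}^H$ is finite Galois if and only if $\mathcal{L}_H$ is bounded above.
   Context: $\mathrm{Aut}(\mathbf{E})$ is the group of all field automorphisms of $\mathbf{E}$. For a subgroup $H$ of $\mathrm{Aut}(\mathbf{E})$, the fixed field is $\mathbf{E}^H=\{\alpha\in\mathbf{E}\mid\sigma(\alpha)=\alpha\text{ for all }\sigma\in H\}$. For a subfield $\mathbf{F}$ of $\mathbf{E}$, $\mathrm{Gal}(\mathbf{E}/\mathbf{F})$ is the group of all $\sigma\in\mathrm{Aut}(\mathbf{E})$ that fix every element of $\mathbf{F}$. An extension $\mathbf{E}/\mathbf{F}$ (not necessarily of finite degree) is called Galois if it is algebraic and $\mathbf{E}^{\mathrm{Gal}(\mathbf{E}/\mathbf{F})}=\mathbf{F}$; it is finite Galois if moreover $[\mathbf{E}:\mathbf{F}]<\infty$. For $\alpha\in\mathbf{E}$, the $H$-orbit is $\mathcal{O}_H(\alpha)=\{\sigma(\alpha)\mid\sigma\in H\}$ and its length is the cardinality $\ell(\mathcal{O}_H(\alpha))=|\mathcal{O}_H(\alpha)|$, possibly infinite. ''$\mathcal{L}_H$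 is bounded above'' means that there is a natural number $N$ such that every $H$-orbit is finite of length at most $N$. *)

(* Defs.v *)
From HB Require Import structures.
From mathcomp Require Import all_boot all_order all_algebra.
From mathcomp Require Import boolp classical_sets functions cardinality.
Set Implicit Arguments.
Unset Strict Implicit.
Unset Printing Implicit Defensive.
Import GRing.Theory.
Local Open Scope classical_set_scope.
Local Open Scope card_scope.
Local Open Scope ring_scope.

(* Automorphisms are represented by their underlying functions E -> E, and     *)
(* subgroups of Aut(E) and subfields of E by sets.                             *)
Definition Aut (E : fieldType) : set (E -> E) :=
  [set f | [/\ zmod_morphism f, monoid_morphism f & bijective f]].

Definition subgroup_of_Aut (E : fieldType) (H : set (E -> E)) : Prop :=
  [/\ H `<=` @Aut E,
      H idfun,
      forall f g, H f -> H g -> H (f \o g)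
    & forall f g, H f -> cancel f g -> cancel g f -> H g].

Definition fixed_field (E : fieldType) (H : set (E -> E)) : set E :=
  [set x | forall f, H f -> f x = x].

Definition Gal (E : fieldType) (F : set E) : set (E -> E) :=
  [set f | @Aut E f /\ forall x, F x -> f x = x].

Definition algebraic_over (E : fieldType) (F : set E) : Prop :=
  forall x : E, exists p : {poly E},
    [/\ p != 0, p \is a polyOver (mem F) & root p x].

Definition basis_over (E : fieldType) (F : set E) (n : nat) (b : 'I_n -> E) :
    Prop :=
  (forall c : 'I_n -> E, (forall i, F (c i)) ->
     \sum_(i < n) c i * b i = 0 -> forall i, c i = 0) /\
  (forall x : E, exists2 c : 'I_n -> E,
     (forall i, F (c i)) & x = \sum_(i < n) c i * b i).

Definition finite_degree (E : fieldType) (F : set E) : Prop :=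
  exists n (b : 'I_n -> E), basis_over F b.

(* The second condition forces F to be a subfield, see fixed_field_divring.    *)
Definition is_galois (E : fieldType) (F : set E) : Prop :=
  algebraic_over F /\ fixed_field (Gal F) = F.

Definition is_finite_galois (E : fieldType) (F : set E) : Prop :=
  is_galois F /\ finite_degree F.

Definition aut_orbit (E : fieldType) (H : set (E -> E)) (x : E) : set E :=
  [set f x | f in H].

Definition orbit_lengths_finite (E : fieldType) (H : set (E -> E)) : Prop :=
  forall x, finite_set (aut_orbit H x).

Definition orbit_lengths_bounded (E : fieldType) (H : set (E -> E)) : Prop :=
  exists N : nat, forall x,
    exists2 n : nat, (n <= N)%N & aut_orbit H x #= `I_n.

Lemma fixed_field_divring (E : fieldType) (H : set (E -> E)) :
  H `<=` @Aut E -> divring_closed (mem (fixed_field H)).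
Proof.
move=> HA.
have mor f : H f -> exists g : {rmorphism E -> E}, f = g.
  case/HA => a m _.
  pose g : {rmorphism E -> E} :=
    HB.pack f (GRing.isZmodMorphism.Build E E f a)
              (GRing.isMonoidMorphism.Build E E f m).
  by exists g.
split=> [|x y|x y]; rewrite !inE.
- by move=> f /mor[g ->]; rewrite rmorph1.
- by move=> Fx Fy f Hf; have [g fg] := mor f Hf; rewrite fg rmorphB -!fg (Fx f Hf) (Fy f Hf).
- by move=> Fx Fy f Hf; have [g fg] := mor f Hf; rewrite fg fmorph_div -!fg (Fx f Hf) (Fy f Hf).
Qed.

(* Main.v *)
(* Write F for the fixed field of H.  If the orbit of x is finite, the product
   of the X - a over the orbit is H-invariant, hence has coefficients in F;
   conversely, H permutes the roots of any polynomial over F.  This gives (i).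

   If [E : F] = n, the restrictions of more than n elements of H to a basis are
   linearly dependent, and Dedekind's argument on the powers of x shows that
   these elements cannot take distinct values at x.  If the orbit lengths are
   bounded, there is a primitive element x, one whose stabilizer in H is trivial:
   a generator of the multiplicative group when F (hence E) is finite, and an
   element of longest orbit otherwise, since a suitable x + c y would have a
   longer orbit if some y were moved by the stabilizer of x.  The powers of x
   below its orbit length then form a basis of E over F. *)

From HB Require Import structures.
Require Import Defs.
From mathcomp Require Import all_boot all_order all_algebra cyclic.
From mathcomp Require Import boolp classical_sets functions cardinality.
Set Implicit Arguments.
Unset Strict Implicit.
Unset Printing Implicit Defensive.
Import GRing.Theory.
Local Open Scope classical_set_scope.
Local Open Scope card_scope.
Local Open Scope ring_scope.

(** * Finite sets, interpolation and finite fields *)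

Lemma finite_set_uniq_seq (T : eqType) (A : set T) :
  finite_set A -> exists2 s : seq T, uniq s & A = [set` s].
Proof.
case/finite_seqP=> s ->; exists (undup s); first exact: undup_uniq.
by apply/seteqP; split=> x /=; rewrite mem_undup.
Qed.

Lemma card_set_uniq_seq (T : eqType) (s : seq T) :
  uniq s -> [set` s] #= `I_(size s).
Proof.
elim: s => [_|a s IH /= /andP[as_ us]].
  have -> : [set` Nil T] = set0 by apply/seteqP; split=> x.
  by rewrite II0 card_eq00.
apply/eq_cardSP; exists a; first exact: mem_head.
rewrite (_ : _ `\ a = [set` s]); first exact: IH.
apply/seteqP; split=> x /=.
  by case; rewrite inE => /orP[/eqP->|].
move=> xs; split; first by rewrite inE xs orbT.
by move=> xa; move: as_; rewrite -xa xs.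
Qed.

Lemma finite_set_bounded (T : choiceType) (A : set T) (n : nat) :
  (forall s : seq T, uniq s -> [set` s] `<=` A -> (size s <= n)%N) ->
  finite_set A.
Proof.
move=> bd; apply: contrapT => /(infinite_set_fset n.+1)[B BA].
by rewrite ltnNge bd.
Qed.

Lemma finite_roots (R : idomainType) (p : {poly R}) :
  p != 0 -> finite_set [set x | root p x].
Proof.
move=> p0; apply: (@finite_set_bounded _ _ (size p)) => s us sp.
by apply/ltnW/max_poly_roots => //; apply/allP.
Qed.

Lemma interpolation (F : fieldType) (s : seq F) (v : F -> F) :
  uniq s -> exists2 p : {poly F}, (size p <= size s)%N &
    {in s, forall a, p.[a] = v a}.
Proof.
elim: s => [_|a s IH /= /andP[nas us]]; first by exists 0; rewrite ?size_poly0.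
have [p sp pv] := IH us.
pose q := \prod_(b <- s) ('X - b%:P).
have qa : q.[a] != 0 by move: nas; rewrite -root_prod_XsubC rootE.
(* Newton's step: the correction vanishes at the old nodes and repairs the value at [a]. *)
exists (p + ((v a - p.[a]) / q.[a]) *: q).
  rewrite (leq_trans (size_polyD _ _)) // geq_max (leq_trans sp) //=.
  by rewrite (leq_trans (size_scale_leq _ _)) // size_prod_XsubC.
move=> b; rewrite inE !hornerE => /orP[/eqP->|bs].
  by rewrite mulfVK // addrC subrK.
have /eqP-> : root q b by rewrite root_prod_XsubC.
by rewrite mulr0 addr0 pv.
Qed.

(** Multiplication by a nonzero [x] permutes the nonzero elements, so comparing their product before
    and after gives [x ^+ size s = 1]. A field with [size s] distinct roots of unity of this
    exponent has a primitive one. *)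
Lemma finite_field_cyclic (F : fieldType) :
  finite_set [set: F] -> exists z : F, forall x, x = 0 \/ exists i, x = z ^+ i.
Proof.
case/finite_set_uniq_seq=> t ut /seteqP[tT _].
pose s := rem 0 t.
have us : uniq s by exact: rem_uniq.
have sE x : (x \in s) = (x != 0) by rewrite mem_rem_uniq // inE (tT x I) andbT.
have s_gt0 : (0 < size s)%N.
  by have: 1 \in s by [rewrite sE oner_eq0]; case: (s).
have ss x : x != 0 -> perm_eq [seq x * y | y <- s] s.
  move=> x0; have inj : injective ( *%R x) by exact: mulfI.
  apply: uniq_perm; rewrite ?map_inj_uniq // => y; rewrite sE.
  apply/mapP/idP => [[z]|y0]; first by rewrite sE => z0 ->; rewrite mulf_neq0.
  by exists (y / x); rewrite ?sE ?mulf_neq0 ?invr_eq0 // mulrCA mulfV ?mulr1.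
have rs : all (size s).-unity_root s.
  apply/allP=> x; rewrite sE unity_rootE => x0; apply/eqP.
  have s0 : \prod_(y <- s) y != 0.
    by rewrite prodf_seq_neq0; apply/allP=> y /=; rewrite sE.
  apply: (mulIf s0); rewrite mul1r -[RHS](perm_big _ (ss x x0)) big_map big_split /=.
  by rewrite big_const_seq count_predT -Monoid.iteropE /=.
have /hasP[z _ zP] := has_prim_root s_gt0 rs us (leqnn _).
exists z => x; have [->|x0] := eqVneq x 0; [by left | right].
have /(prim_rootP zP)[i ->] : x ^+ size s = 1; last by exists i.
by apply/eqP; rewrite -unity_rootE; apply: (allP rs); rewrite sE.
Qed.

Lemma finite_poly_of_size (R : nzRingType) (A : set R) (n : nat) :
  finite_set A ->
  finite_set [set p : {poly R} | (size p <= n)%N /\ forall i, A p`_i].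
Proof.
move=> finA; elim: n => [|n IH].
  apply: sub_finite_set (finite_set1 0) => p [/=].
  by rewrite leqn0 size_poly_eq0 => /eqP.
apply: sub_finite_set (finite_image2 (fun q c => q * 'X + c%:P) IH finA) => p.
case=> sp Ap; exists (\poly_(i < n) p`_i.+1).
  split=> [|i]; first exact: size_poly.
  rewrite coef_poly; case: ltnP => // ni.
  by have := Ap i.+1; rewrite nth_default // (leq_trans sp).
exists p`_0; first exact: Ap.
apply/polyP=> [[|i]]; rewrite coefD coefMX coefC /= ?add0r // addr0 coef_poly.
by case: ltnP => // ni; rewrite nth_default // (leq_trans sp).
Qed.

(** * Invariant polynomials and finite orbits *)

Lemma Aut_rmorphism (E : fieldType) (f : E -> E) :
  Aut f -> exists g : {rmorphism E -> E}, f = g.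
Proof.
case=> a m _.
pose g : {rmorphism E -> E} :=
  HB.pack f (GRing.isZmodMorphism.Build E E f a)
            (GRing.isMonoidMorphism.Build E E f m).
by exists g.
Qed.

Lemma fixed_coef (E : fieldType) (H : set (E -> E)) (p : {poly E}) :
  H `<=` @Aut E -> (forall f, H f -> map_poly f p = p) ->
  forall i, fixed_field H p`_i.
Proof.
move=> HA pf i f Hf; have [g fg] := Aut_rmorphism (HA _ Hf).
by rewrite -[in RHS](pf f Hf) fg coef_map.
Qed.

Lemma root_fixed (E : fieldType) (H : set (E -> E)) (p : {poly E}) f x :
  H `<=` @Aut E -> p \is a polyOver (mem (fixed_field H)) -> H f ->
  root p x -> root p (f x).
Proof.
move=> HA pF Hf; have [g fg] := Aut_rmorphism (HA _ Hf).
rewrite fg => /(rmorph_root g); congr root; apply/polyP=> i.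
rewrite coef_map /= -fg.
have [ip|ip] := ltnP i (size p); last by rewrite nth_default // fg rmorph0.
move/all_nthP: pF => /(_ 0 i ip); rewrite inE; exact.
Qed.

(** This makes the second condition of [is_galois] automatic for fixed fields, leaving only
    algebraicity to be compared with the orbits. *)
Lemma fixed_field_Gal (E : fieldType) (H : set (E -> E)) :
  H `<=` @Aut E -> fixed_field (Gal (fixed_field H)) = fixed_field H.
Proof.
move=> HA; apply/seteqP; split=> x Fx f; last by case=> _; exact.
by move=> Hf; apply: Fx; split; [exact: HA | move=> y; exact].
Qed.

(** An injective map of a finite orbit into itself is onto. *)
Lemma aut_orbit_perm (E : fieldType) (H : set (E -> E)) (s : seq E) x f :
  subgroup_of_Aut H -> H f -> uniq s -> aut_orbit H x = [set` s] ->
  perm_eq [seq f a | a <- s] s.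
Proof.
case=> HA _ Hcomp _ Hf us sE; have [g fg] := Aut_rmorphism (HA _ Hf).
have ufs : uniq [seq f a | a <- s] by rewrite fg map_inj_uniq //; exact: fmorph_inj.
have sub : {subset [seq f a | a <- s] <= s}.
  move=> _ /mapP[a sa ->].
  have [h Hh <-] : aut_orbit H x a by rewrite sE.
  suff: [set` s] (f (h x)) by [].
  by rewrite -sE; exists (f \o h) => //; exact: Hcomp.
have [|_] := uniq_min_size ufs sub; first by rewrite size_map.
exact: uniq_perm.
Qed.

Lemma aut_orbit_poly_fixed (E : fieldType) (H : set (E -> E)) (s : seq E) x :
  subgroup_of_Aut H -> uniq s -> aut_orbit H x = [set` s] ->
  forall i, fixed_field H (\prod_(a <- s) ('X - a%:P))`_i.
Proof.
move=> hH us sE; have [HA _ _ _] := hH; apply: fixed_coef => // f Hf.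
have [g fg] := Aut_rmorphism (HA _ Hf).
rewrite fg map_prod_XsubC -fg -(big_map f xpredT (fun a => 'X - a%:P)).
by apply: perm_big; exact: aut_orbit_perm sE.
Qed.

Lemma aut_orbit_refl (E : fieldType) (H : set (E -> E)) x :
  subgroup_of_Aut H -> aut_orbit H x x.
Proof. by case=> _ H1 _ _; exists idfun. Qed.

Lemma algebraic_finite_orbits (E : fieldType) (H : set (E -> E)) :
  subgroup_of_Aut H ->
  algebraic_over (fixed_field H) <-> orbit_lengths_finite H.
Proof.
move=> hH; have [HA _ _ _] := hH; split=> [alg x|fin x].
  have [p [p0 pF px]] := alg x.
  apply: sub_finite_set (finite_roots p0) => _ [f Hf <-].
  exact: root_fixed pF Hf px.
have [s us sE] := finite_set_uniq_seq (fin x).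
exists (\prod_(a <- s) ('X - a%:P)); split.
- exact/monic_neq0/monic_prod_XsubC.
- apply/(all_nthP 0) => i _; rewrite inE; exact: aut_orbit_poly_fixed sE i.
- rewrite root_prod_XsubC; suff: [set` s] x by [].
  by rewrite -sE; exact: aut_orbit_refl.
Qed.

Lemma is_galois_fixed_field (E : fieldType) (H : set (E -> E)) :
  subgroup_of_Aut H -> is_galois (fixed_field H) <-> orbit_lengths_finite H.
Proof.
move=> hH; have [HA _ _ _] := hH; rewrite -algebraic_finite_orbits //.
by split=> [[]|alg] //; split=> //; exact: fixed_field_Gal.
Qed.

(** * The degree bounds the orbit lengths *)

Lemma aut_orbit_size_le_degree (E : fieldType) (H : set (E -> E)) n
    (b : 'I_n -> E) x (s : seq E) :
  H `<=` @Aut E -> basis_over (fixed_field H) b ->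
  uniq s -> [set` s] `<=` aut_orbit H x -> (size s <= n)%N.
Proof.
move=> HA [_ span] us sx; rewrite leqNgt; apply/negP => ns.
have /choice[h hP] (i : 'I_(size s)) : exists g : {rmorphism E -> E},
    H g /\ g x = s`_i.
  have [f Hf fx] := sx _ (mem_nth 0 (ltn_ord i)).
  by have [g fg] := Aut_rmorphism (HA _ Hf); exists g; rewrite -fg.
(* There is one row per automorphism and there are more rows than the [n] columns, so some nonzero
   [v] satisfies [v *m A = 0]. *)
pose A := \matrix_(i, j) h i (b j).
have : kermx A != 0.
  by rewrite kermx_eq0 -row_leq_rank -ltnNge (leq_ltn_trans (rank_leq_col A)).
case/rowV0Pn=> v /sub_kermxP vA v0.
(* The relation spreads from the basis to all of [E], each [h i] being linear over the fixed
   field. *)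
have vh y : \sum_i v 0 i * h i y = 0.
  have [c Fc ->] := span y.
  transitivity (\sum_j c j * (v *m A) 0 j); last first.
    by rewrite vA big1 // => j _; rewrite mxE mulr0.
  under eq_bigr => i _ do rewrite raddf_sum mulr_sumr.
  rewrite exchange_big; apply: eq_bigr => j _; rewrite mxE mulr_sumr.
  apply: eq_bigr => i _; rewrite mxE /= rmorphM mulrCA.
  by rewrite (Fc j) //; have [] := hP i.
(* Apply [vh] to the powers of [x], which [h i] sends to the powers of the [i]-th entry of [s]. *)
have vp (p : {poly E}) : \sum_i v 0 i * p.[s`_i] = 0.
  under eq_bigr => i _ do rewrite horner_coef mulr_sumr.
  rewrite exchange_big big1 // => k _.
  transitivity (p`_k * \sum_i v 0 i * h i (x ^+ k)); last by rewrite vh mulr0.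
  rewrite mulr_sumr.
  by apply: eq_bigr => i _; have [_ hx] := hP i; rewrite rmorphXn /= hx mulrCA.
case/negP: v0; apply/eqP/rowP => i; rewrite mxE.
(* Among the entries of [s], only the [i]-th is not a root of [p], so [vp] isolates [v 0 i]. *)
pose p := \prod_(a <- rem s`_i s) ('X - a%:P).
have := vp p; rewrite (bigD1 i) //= big1 => [|j ji].
  move/eqP; rewrite addr0 mulf_eq0 => /orP[/eqP//|].
  by rewrite -rootE root_prod_XsubC mem_rem_uniq // !inE eqxx.
suff /eqP-> : root p s`_j by rewrite mulr0.
by rewrite root_prod_XsubC mem_rem_uniq // !inE nth_uniq // ji mem_nth.
Qed.

(** Counting with duplicate-free lists inside an orbit gives a bound that can be used, or proved,
    before the orbit is known to be finite. *)
Lemma orbit_lengths_boundedP (E : fieldType) (H : set (E -> E)) :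
  orbit_lengths_bounded H <->
  exists N, forall x (s : seq E), uniq s -> [set` s] `<=` aut_orbit H x ->
    (size s <= N)%N.
Proof.
split=> [] [N bN]; exists N => x.
  move=> s us sx; have [n nN xn] := bN x.
  have [t ut tE] : exists2 t : seq E, uniq t & aut_orbit H x = [set` t].
    by apply: finite_set_uniq_seq; apply/finite_setP; exists n.
  apply: leq_trans nN; rewrite tE in sx xn.
  have /card_eq_II <- : `I_(size t) #= `I_n.
    by apply: card_eq_trans xn; rewrite card_eq_sym card_set_uniq_seq.
  exact: uniq_leq_size.
have [s us sE] := finite_set_uniq_seq (finite_set_bounded (bN x)).
exists (size s); last by rewrite sE card_set_uniq_seq.
by apply: (bN x) => //; rewrite sE.
Qed.

Lemma orbit_lengths_bounded_finite (E : fieldType) (H : set (E -> E)) :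
  orbit_lengths_bounded H -> orbit_lengths_finite H.
Proof.
case=> N bN x; have [n _ xn] := bN x.
by apply/finite_setP; exists n.
Qed.

(** * Existence of a primitive element *)

Lemma longest_aut_orbit (E : fieldType) (H : set (E -> E)) :
  orbit_lengths_bounded H -> exists x (s : seq E),
    [/\ uniq s, aut_orbit H x = [set` s] &
      forall y (t : seq E), uniq t -> [set` t] `<=` aut_orbit H y ->
        (size t <= size s)%N].
Proof.
move=> Hb; have /orbit_lengths_boundedP[N bN] := Hb.
(* Maximise over lists inside orbits: the empty list gives [P 0] and [N] is an upper bound. The full
   orbit [t] of the maximiser contains [s], so it is at least as long. *)
pose P n := `[< exists x (s : seq E),
  [/\ uniq s, [set` s] `<=` aut_orbit H x & size s = n] >].
have exP : exists n, P n by exists 0%N; apply/asboolP; exists 0, [::].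
have ubP n : P n -> (n <= N)%N.
  by move/asboolP => [x [s [us sx <-]]]; exact: bN sx.
case: (ex_maxnP exP ubP) => n /asboolP[x [s [us sx <-]]] smax.
have [t ut tE] := finite_set_uniq_seq (orbit_lengths_bounded_finite Hb x).
exists x, t; split=> // y r ur ry; apply: (@leq_trans (size s)).
  by apply: smax; apply/asboolP; exists y, r.
by apply: uniq_leq_size us _; rewrite tE in sx.
Qed.

(** Each element is a root of its orbit polynomial, of degree at most [N]. Over a finite fixed field
    there are finitely many such polynomials, each with finitely many roots. *)
Lemma finite_of_finite_fixed_field (E : fieldType) (H : set (E -> E)) :
  subgroup_of_Aut H -> orbit_lengths_bounded H ->
  finite_set (fixed_field H) -> finite_set [set: E].
Proof.
move=> hH /[dup] Hb /orbit_lengths_boundedP[N bN] finF.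
pose D := [set p : {poly E} |
  p != 0 /\ ((size p <= N.+1)%N /\ forall i, fixed_field H p`_i)].
have finD : finite_set D.
  by apply: sub_finite_set (finite_poly_of_size N.+1 finF) => p [].
apply: sub_finite_set (bigcup_finite finD _); last first.
  by move=> p [p0 _]; exact: finite_roots p0.
move=> x _; have [s us sE] :=
  finite_set_uniq_seq (orbit_lengths_bounded_finite Hb x).
exists (\prod_(a <- s) ('X - a%:P)); last first.
  rewrite /= root_prod_XsubC; suff: [set` s] x by [].
  by rewrite -sE; exact: aut_orbit_refl.
split; first exact/monic_neq0/monic_prod_XsubC.
split; last exact: aut_orbit_poly_fixed sE.
by rewrite size_prod_XsubC ltnS (bN x) // sE.
Qed.

(** The inverse of [f] composed with [g] fixes [x], hence [y]. *)
Lemma aut_eq_of_eq_at (E : fieldType) (H : set (E -> E)) x y f g :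
  subgroup_of_Aut H -> (forall k, H k -> k x = x -> k y = y) ->
  H f -> H g -> f x = g x -> f y = g y.
Proof.
move=> [HA _ Hcomp Hinv] xy Hf Hg fgx; have [_ _ [f' f'K fK']] := HA f Hf.
have Hf' : H f' by exact: Hinv f'K fK'.
have /= := xy (f' \o g) (Hcomp _ _ Hf' Hg); rewrite -fgx f'K => /(_ erefl) gy.
by rewrite -[in LHS]gy fK'.
Qed.

Lemma primitive_of_infinite (E : fieldType) (H : set (E -> E)) :
  subgroup_of_Aut H -> orbit_lengths_bounded H ->
  infinite_set (fixed_field H) ->
  exists x, forall f, H f -> f x = x -> forall y, f y = y.
Proof.
move=> hH Hb infF; have [HA H1 Hcomp _] := hH.
have [x [s [us sE smax]]] := longest_aut_orbit Hb.
exists x => k Hk kx y; apply: contrapT => ky.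
have [t ut tE] := finite_set_uniq_seq (orbit_lengths_bounded_finite Hb y).
(* These include every [c] with [a + c * b = a' + c * b'] for some [b] distinct from [b']. Pairs
   with [b = b'] only contribute 0, the value of division by 0. *)
pose bad := [seq (p.1 - p.2) / (q.2 - q.1)
  | p <- [seq (a, a') | a <- s, a' <- s], q <- [seq (b, b') | b <- t, b' <- t]].
have [c [Fc cbad]] : (fixed_field H `\` [set` bad]) !=set0.
  by apply: infinite_setN0; apply: infinite_setD => //; exact: finite_seq.
pose z := x + c * y.
have fz f : H f -> f z = f x + c * f y.
  move=> Hf; have [g fg] := Aut_rmorphism (HA _ Hf).
  by rewrite /z fg rmorphD rmorphM /= -fg (Fc f Hf).
have inS f : H f -> f x \in s.
  by move=> Hf; suff: [set` s] (f x) by []; rewrite -sE; exists f.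
have inT f : H f -> f y \in t.
  by move=> Hf; suff: [set` t] (f y) by []; rewrite -tE; exists f.
(* As [c] avoids [bad], the image of [z] determines those of [x] and [y]. *)
have sep f g : H f -> H g -> f z = g z -> f x = g x /\ f y = g y.
  move=> Hf Hg; rewrite !fz // => e; have [fgy|fgy] := eqVneq (f y) (g y).
    by split=> //; move: e; rewrite fgy => /addIr.
  case: cbad; rewrite /= (_ : c = (f x - g x) / (g y - f y)); last first.
    rewrite -[LHS](mulfK (_ : g y - f y != 0)) ?subr_eq0 1?eq_sym //.
    congr (_ / _); rewrite mulrBr; apply/eqP; rewrite subr_eq addrAC eq_sym subr_eq.
    by rewrite e addrC.
  apply: (allpairs_f (fun p q : E * E => (p.1 - p.2) / (q.2 - q.1))
    (x := (f x, g x)) (y := (f y, g y))); apply/allpairsP.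
    by exists (f x, g x); rewrite !inS.
  by exists (f y, g y); rewrite !inT.
(* [h a] carries [x] to [a]; off the orbit, [idfun] is a placeholder. *)
have /choice[h hP] a : exists f, H f /\ (a \in s -> f x = a).
  have [as_|_] := boolP (a \in s); last by exists idfun.
  have [f Hf fx] : aut_orbit H x a by rewrite sE.
  by exists f; split.
have zkz : k z <> z by move=> /(sep k idfun Hk H1)[_].
have xs : x \in s by exact: (inS idfun).
(* Both [idfun] and [k] fix [x] but they differ at [z], so at least one of them differs there from
   [h x]. *)
have [w [Hw wx wz]] : exists g, [/\ H g, g x = x & g z <> h x z].
  have [zh|zh] := eqVneq z (h x z); last by exists idfun; split=> //; exact/eqP.
  by exists k; split=> //; rewrite -zh.
(* The orbit of [z] has a point over each [a] in [s] and a second one over [x], so it exceeds the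
   maximal length. *)
suff: (size (w z :: [seq h a z | a <- s]) <= size s)%N by rewrite /= size_map ltnn.
apply: (smax z); last first.
  move=> u /=; rewrite inE => /orP[/eqP->|/mapP[a _ ->]]; first by exists w.
  by exists (h a) => //; have [] := hP a.
rewrite cons_uniq map_inj_in_uniq ?us ?andbT => [|a a' ina ina' haa]; last first.
  have [[Ha ha] [Ha' ha']] := (hP a, hP a').
  by have [] := sep _ _ Ha Ha' haa; rewrite ha // ha'.
apply/mapP => -[a ina wa]; have [Ha ha] := hP a.
have [] := sep _ _ Hw Ha wa; rewrite wx ha // => xa _.
by apply: wz; rewrite wa xa.
Qed.

Lemma primitive_exists (E : fieldType) (H : set (E -> E)) :
  subgroup_of_Aut H -> orbit_lengths_bounded H ->
  exists x, forall f, H f -> f x = x -> forall y, f y = y.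
Proof.
move=> hH Hb; have [finF|] := pselect (finite_set (fixed_field H)); last first.
  exact: primitive_of_infinite.
have [x xP] := finite_field_cyclic (finite_of_finite_fixed_field hH Hb finF).
have [HA _ _ _] := hH; exists x => f Hf fx y.
have [g fg] := Aut_rmorphism (HA _ Hf); move: fx; rewrite fg => gx.
by have [->|[i ->]] := xP y; rewrite ?rmorph0 // rmorphXn /= gx.
Qed.

(** * The power basis of a primitive element *)

(* y is the value at x of the polynomial p of least degree interpolating
   f x |-> f y for f in H; p is H-invariant by uniqueness of interpolation. *)
Lemma finite_degree_of_bounded (E : fieldType) (H : set (E -> E)) :
  subgroup_of_Aut H -> orbit_lengths_bounded H ->
  finite_degree (fixed_field H).
Proof.
move=> hH Hb; have [HA H1 Hcomp Hinv] := hH.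
have [x xP] := primitive_exists hH Hb.
have [s us sE] := finite_set_uniq_seq (orbit_lengths_bounded_finite Hb x).
have ins a : a \in s <-> aut_orbit H x a by rewrite sE.
exists (size s), (fun i => x ^+ i); split=> [c Fc c0 i|y].
  (* A relation [c], extended by 0 beyond its index range, is a polynomial with root [x]. It then
     has all [size s] orbit points as roots, too many for its size. *)
  pose p := \poly_(j < size s) oapp c 0 (insub j).
  have pc j : p`_j = oapp c 0 (insub j).
    by rewrite coef_poly; case: ltnP => // sj; rewrite insubF // ltnNge sj.
  have pF : p \is a polyOver (mem (fixed_field H)).
    apply/(all_nthP 0) => j _; rewrite inE pc; case: insubP => [u _ _|_] //=.
    by move=> f Hf; have [g ->] := Aut_rmorphism (HA _ Hf); rewrite rmorph0.
  have px : root p x.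
    rewrite rootE horner_poly -[X in _ == X]c0; apply/eqP/eq_bigr => j _.
    by rewrite valK.
  suff p0 : p = 0 by have := pc i; rewrite valK p0 coef0.
  apply: roots_geq_poly_eq0 us (size_poly _ _).
  by apply/allP => a /ins[f Hf <-]; exact: root_fixed pF Hf px.
(* The map [f x |-> f y] is well defined because the stabilizer of [x] is trivial; off the orbit the
   value 0 is arbitrary. *)
have /choice[v vP] a : exists b, forall f, H f -> f x = a -> f y = b.
  have [[g Hg <-]|na] := pselect (aut_orbit H x a).
    exists (g y) => f Hf; apply: aut_eq_of_eq_at hH _ Hf Hg.
    by move=> k Hk kx; exact: xP.
  by exists 0 => f Hf fx; case: na; exists f.
have [p sp pv] := interpolation v us.
have pf f : H f -> p.[f x] = f y.
  move=> Hf; rewrite pv; first exact/esym/vP.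
  by apply/ins; exists f.
have Fp : forall i, fixed_field H p`_i.
  apply: fixed_coef => // f Hf; have [g fg] := Aut_rmorphism (HA _ Hf).
  apply/eqP; rewrite -subr_eq0; apply/eqP; apply: roots_geq_poly_eq0 us _.
    apply/allP => a /ins[k Hk <-].
    (* Writing [k x] as [f (f' (k x))], the image of [p] under [f] takes there the value
       [f (f' (k y)) = k y], as [p] does. *)
    have [_ _ [f' f'K fK']] := HA f Hf; have Hf' := Hinv _ _ Hf f'K fK'.
    rewrite rootE hornerD hornerN pf // -[X in _.[X]](fK' (k x)) fg horner_map -fg.
    by rewrite (pf _ (Hcomp _ _ Hf' Hk)) /= fK' subrr.
  by rewrite (leq_trans (size_polyD _ _)) // geq_max size_polyN sp
             (leq_trans (size_poly _ _)).
exists (fun i => p`_i) => [i|]; first exact: Fp.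
by rewrite -[LHS](pf idfun H1) (horner_coef_wide _ sp).
Qed.

Theorem theorem5p2 (E : fieldType) (H : set (E -> E))
    (hH : subgroup_of_Aut H) :
  (is_galois (fixed_field H) <-> orbit_lengths_finite H) /\
  (is_finite_galois (fixed_field H) <-> orbit_lengths_bounded H).
Proof.
split; first exact: is_galois_fixed_field.
have [HA _ _ _] := hH; split=> [[_ [n [b bP]]]|Hb].
  by apply/orbit_lengths_boundedP; exists n => x s;
     exact: aut_orbit_size_le_degree bP.
split; last exact: finite_degree_of_bounded.
by apply/is_galois_fixed_field => //; exact: orbit_lengths_bounded_finite.
Qed.
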